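(* Let $W=[w_{mn}]\in\mathbb{R}^{N\times N}$ ($N\ge3$) be the transition matrix of a continuous-time Markov jump process satisfying the assumptions of the context, with steady state $\pi$, let $\tau>0$, and let $a,b\in\mathbb{R}^N$ be observables with $D_a^\tau+D_b^\tau\neq0$. Let $\mathcal{K}$ be the set of cycles of a uniform cycle decomposition of the finite-time currents $J_{mn}$. Then $$\frac{|\delta C_{ba}^\tau|^2}{D_a^\tau+D_b^\tau}\le\tau\sigma\,\min\left\{\|a^2+b^2\|_\infty,\ \left[\frac{\max_{c\in\mathcal{K}}\ell_c}{2N\tan(\pi/N)}\right]^2\right\}.$$
   Context: Setting. $w_{mn}\ge0$ for $m\neq n$ is the jump rate from state $n$ to state $m$, $w_{nn}=-\sum_{m\neq n}w_{mn}$, and $\dot p_t=Wp_t$. Local detailed balance is assumed: $w_{mn}>0$ if and only if $w_{nm}>0$ for $m\ne n$. The eigenvalue $0$ of $W$ is simple and all other eigenvalues have negative real part. $\pi$ is the steady state: a probability vector with $W\pi=0$. $\Pi:=\mathrm{diag}(\pi_1,\dots,\pi_N)$. Entropy production rate: $\sigma:=\sum_{m>n}(w_{mn}\pi_n-w_{nm}\pi_m)\ln\frac{w_{mn}\pi_n}{w_{nm}\pi_m}$ (pairs with zero rates contribute $0$). Correlations: $C_{ba}^\tau:=b^\top e^{W\tau}\Pi a$, $\delta C_{ba}^\tau:=C_{ba}^\tau-C_{ab}^\tau$, and $D_a^\tau:=C_{aa}^0-C_{aa}^\tau$ (similarly $D_b^\tau$). Also $\|a^2+b^2\|_\infty:=\max_n(a_n^2+b_n^2)$.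 Cycles: let $J_{mn}:=[e^{W\tau}]_{mn}\pi_n-[e^{W\tau}]_{nm}\pi_m$, which satisfies $\sum_mJ_{mn}=0$ for all $n$. A cycle $c=(n_1,\dots,n_{|c|})$ is a directed cycle of $|c|\ge3$ distinct states with edges $n_i\to n_{i+1}$ (index $|c|+1\equiv1$). A uniform cycle decomposition is a finite set $\mathcal{K}$ of cycles with positive weights $J^c$ such that every edge $n\to m$ of every $c\in\mathcal{K}$ has $J_{mn}>0$, and for each directed edge $e=(n\to m)$ with $J_{mn}>0$ one has $J_{mn}=\sum_{c\in\mathcal{K}:\,e\in c}J^c$. The length of a cycle is $\ell_c:=\sum_{i=1}^{|c|}\sqrt{(a_{n_i}-a_{n_{i+1}})^2+(b_{n_i}-b_{n_{i+1}})^2}$. If all $J_{mn}=0$, then $\mathcal{K}$ is empty and the maximum is read as $0$. *)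

(* Defs.v *)
From mathcomp Require Import all_boot all_order all_algebra.
From mathcomp Require Import finmap complex.
From mathcomp Require Import all_classical all_reals all_analysis.

Set Implicit Arguments.
Unset Strict Implicit.
Unset Printing Implicit Defensive.

Import Order.TTheory GRing.Theory Num.Theory.
Import numFieldNormedType.Exports.

Local Open Scope ring_scope.

Section Definitions.
Variables (R : realType) (N : nat).
Implicit Types (A W J : 'M[R]_N) (a b p : 'cV[R]_N) (t : R).

Definition expmx A : 'M[R]_N :=
  limn (series (fun k : nat => (k`!%:R)^-1 *: (A ^+ k))).

(* W m n is the rate of the jump from state n to state m, so that the
   off-diagonal entries are nonnegative and the columns sum to zero. *)
Definition jump_rate_matrix W : Prop :=
  (forall m n, m != n -> 0 <= W m n) /\
  (forall n, W n n = - \sum_(m | m != n) W m n).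

Definition local_detailed_balance W : Prop :=
  forall m n, m != n -> 0 < W m n <-> 0 < W n m.

(* Eigenvalues are taken in the algebraic closure R[i]; simplicity of 0 is
   multiplicity one as a root of the characteristic polynomial. *)
Definition spectral_assumption W : Prop :=
  let WC : 'M[R[i]]_N := map_mx (@real_complex R) W in
  mup 0 (char_poly WC) = 1%N /\
  (forall z : R[i], eigenvalue WC z -> z != 0 -> complex.Re z < 0).

Definition steady_state W p : Prop :=
  [/\ forall n, 0 <= p n 0, \sum_n p n 0 = 1 & W *m p = 0].

(* When the rates of a pair of states vanish the first factor is 0, so the
   value of ln at the meaningless ratio is irrelevant. *)
Definition entropy_production W p : R :=
  \sum_(n < N) \sum_(m < N | (n < m)%N)
    (W m n * p n 0 - W n m * p m 0) *
    ln ((W m n * p n 0) / (W n m * p m 0)).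

(* corr W p b a t is the correlation C_{ba}^t = b^T e^{Wt} diag(p) a. *)
Definition corr W p b a t : R :=
  (b^T *m expmx (t *: W) *m diag_mx p^T *m a) 0 0.

Definition dcorr W p b a t : R := corr W p b a t - corr W p a b t.

Definition dissim W p a t : R := corr W p a a 0 - corr W p a a t.

(* The entry at (m, n) is the net current along the directed edge n -> m. *)
Definition current W p t : 'M[R]_N :=
  \matrix_(m, n)
    (expmx (t *: W) m n * p n 0 - expmx (t *: W) n m * p m 0).

(* The cycle n_1 -> ... -> n_k -> n_1 is the sequence [:: n_1; ...; n_k], and
   next c n is the state following n. *)
Definition is_cycle (c : seq 'I_N) : bool := uniq c && (3 <= size c)%N.

Definition edge_in (n m : 'I_N) (c : seq 'I_N) : bool :=
  (n \in c) && (next c n == m).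

Definition uniform_cycle_decomposition J (K : {fset seq 'I_N})
    (w : seq 'I_N -> R) : Prop :=
  [/\ forall c, c \in K -> is_cycle c,
      forall c, c \in K -> 0 < w c,
      forall c n m, c \in K -> edge_in n m c -> 0 < J m n &
      forall n m, 0 < J m n -> J m n = \sum_(c <- K | edge_in n m c) w c].

Definition cycle_length a b (c : seq 'I_N) : R :=
  \sum_(n <- c) Num.sqrt ((a n 0 - a (next c n) 0) ^+ 2 +
                          (b n 0 - b (next c n) 0) ^+ 2).

(* The two maxima below are of nonnegative numbers, so that the default value
   0 only matters for an empty range. *)
Definition max_cycle_length a b (K : {fset seq 'I_N}) : R :=
  \big[Num.max/0]_(c <- K) cycle_length a b c.

Definition sqnorm_sup a b : R :=
  \big[Num.max/0]_(n < N) (a n 0 ^+ 2 + b n 0 ^+ 2).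

End Definitions.

(* Main.v *)
(** Approximating e^(tW) by the Euler products (1 + tW/n)^n, the relative entropy
    between the stationary two-time law A and its reversal is subadditive along
    products of commuting kernels (log-sum inequality) and equals t sigma / n for
    one Euler factor.  Together with
    (u - v) ln (u / v) >= 4 (u - v) y - 2 (u + v) y^2
    this gives, in the limit and for every antisymmetric y,
    2 (sum A y)^2 <= t sigma (sum A y^2).
    With y the cross product of the points (a_n, b_n) this is the first bound.
    For the second one, decompose the current into cycles, bound the area enclosed
    by each cycle by the polygonal isoperimetric inequality, and use y = +- the
    distance of the points.

    The isoperimetric inequality: to an edge of length l of a closed polygon of
    perimeter L attach the angle theta = pi l / L.  The functional
    cot theta |z - z'|^2 - 2 z x z' is subadditive under concatenation of edges, so
    that sum cot theta_i l_i^2 dominates four times the area, while Jensen's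
    inequality for the concave function theta^2 cot theta bounds that sum by
    L^2 / (N tan (pi / N)). *)

Require Import Defs.
From mathcomp Require Import all_boot all_order all_algebra.
From mathcomp Require Import finmap complex.
From mathcomp Require Import ring lra.
From mathcomp Require Import all_classical all_reals all_analysis.

Set Implicit Arguments.
Unset Strict Implicit.
Unset Printing Implicit Defensive.

Import Order.TTheory GRing.Theory Num.Theory.
Import numFieldNormedType.Exports.
Local Open Scope classical_set_scope.
Local Open Scope ring_scope.

(** * Concavity of x^2 cot x *)

Lemma is_derive_ge0_le (R : realType) (f df : R -> R) (a b : R) :
  a <= b -> (forall x, a <= x <= b -> is_derive x 1 f (df x)) ->
  (forall x, a <= x <= b -> 0 <= df x) -> f a <= f b.
Proof.
move=> ab dfE df_ge0.
have [c|c|c c_in fE] := @MVT_segment R f df a b ab.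
- by rewrite in_itv /= => /andP[/ltW ac /ltW cb]; apply: dfE; rewrite ac.
- apply: derivable_within_continuous => x; rewrite in_itv /= => x_in.
  exact: (@ex_derive _ _ _ _ _ _ _ (dfE x x_in)).
rewrite -subr_ge0 fE mulr_ge0 ?subr_ge0// df_ge0//.
Qed.

Lemma sin_le_id (R : realType) (x : R) : 0 <= x -> sin x <= x.
Proof.
move=> x_ge0.
have := @is_derive_ge0_le R (fun y => y - sin y) (fun y => 1 - cos y) 0 x x_ge0.
rewrite sin0 !subr0 subr_ge0; apply => y _; by rewrite subr_ge0 cos_le1.
Qed.

Lemma mul_cos_le_sin (R : realType) (x : R) :
  0 <= x <= pi -> x * cos x <= sin x.
Proof.
move=> /andP[x_ge0 x_le].
have := @is_derive_ge0_le R (fun y => sin y - y * cos y)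
  (fun y => y * sin y) 0 x x_ge0.
rewrite sin0 mul0r !subr0 subr_ge0; apply => y /andP[y_ge0 y_le].
  by apply: is_derive_eq; rewrite /GRing.scale /=; ring.
by rewrite mulr_ge0// sin_ge0_pi// y_ge0 (le_trans y_le).
Qed.

Lemma div_sin_le (R : realType) (x y : R) : 0 < x -> x <= y -> y < pi ->
  x / sin x <= y / sin y.
Proof.
move=> x_gt0 xy y_lt.
have s_gt0 z : x <= z <= y -> 0 < sin z.
  by move=> /andP[xz zy]; rewrite sin_gt0_pi// (lt_le_trans x_gt0) ?(le_lt_trans zy).
apply: (@is_derive_ge0_le R (fun y => y / sin y)
  (fun z => (sin z - z * cos z) / sin z ^+ 2)) => // z z_in; have := s_gt0 _ z_in => sz.
  have sz0 : sin z != 0 by rewrite gt_eqF.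
  apply: is_derive_eq; rewrite /GRing.scale /=; field: (cos2sin2 z); exact: sz0.
rewrite divr_ge0 ?sqr_ge0// subr_ge0 mul_cos_le_sin//.
case/andP: z_in => xz zy.
by rewrite (le_trans (ltW x_gt0) xz) (le_trans zy (ltW y_lt)).
Qed.

(* The derivative of the concave function x |-> x^2 cot x. *)
Definition sqrcot_slope (R : realType) (x : R) : R :=
  2 * x * cos x / sin x - x ^+ 2 / sin x ^+ 2.

Lemma is_derive_sqrcot (R : realType) (x : R) : sin x != 0 ->
  is_derive x 1 (fun y : R => y ^+ 2 * (cos y / sin y)) (sqrcot_slope x).
Proof.
move=> sx; apply: is_derive_eq; rewrite /GRing.scale /= /sqrcot_slope.
have c2 : cos x ^+ 2 = 1 - sin x ^+ 2 by rewrite cos2sin2.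
field: c2; exact: sx.
Qed.

(** On this interval the slope equals [1 - sin z ^+ 2 - (z / sin z - cos z) ^+ 2], and both squared
    quantities are nonnegative and grow with [z]. *)
Lemma sqrcot_slope_le (R : realType) (x y : R) : 0 < x -> x <= y -> y <= pi / 2 ->
  sqrcot_slope y <= sqrcot_slope x.
Proof.
move=> x_gt0 xy y_le.
have E (z : R) : 0 < z -> z <= pi / 2 ->
    [/\ 0 <= sin z, 0 <= cos z, cos z <= z / sin z &
     sqrcot_slope z = 1 - sin z ^+ 2 - (z / sin z - cos z) ^+ 2].
  move=> z_gt0 z_le; have := pi_gt0 R => pi0.
  have s_gt0 : 0 < sin z by rewrite sin_gt0_pi// z_gt0/=; lra.
  split; first exact: ltW.
  - by rewrite cos_ge0_pihalf// z_le andbT; lra.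
  - rewrite ler_pdivlMr//.
    have := sin_le_id (ltW z_gt0); have := cos_le1 z.
    have : 0 <= cos z by rewrite cos_ge0_pihalf// z_le andbT; lra.
    nra.
  rewrite -cos2sin2 /sqrcot_slope; field; exact: lt0r_neq0.
have y_gt0 := lt_le_trans x_gt0 xy.
have [sx cx rx ->] := E _ x_gt0 (le_trans xy y_le).
have [sy cy ry ->] := E _ y_gt0 y_le.
have pi0 := pi_gt0 R.
have r_le : x / sin x <= y / sin y by apply: div_sin_le => //; lra.
have s_le : sin x <= sin y.
  move: xy; rewrite le_eqVlt => /orP[/eqP->//|xy].
  by rewrite ltW// ltr_sin ?in_itv//=; apply/andP; split; lra.
have c_le : cos y <= cos x.
  move: xy; rewrite le_eqVlt => /orP[/eqP->//|xy].
  by rewrite ltW// ltr_cos ?in_itv//=; apply/andP; split; lra.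
nra.
Qed.

(** The mean value theorem turns the monotone slope into a tangent bound, on either side of [x]. *)
Lemma sqrcot_le_tangent (R : realType) (x y : R) :
  0 < x <= pi / 2 -> 0 < y <= pi / 2 ->
  y ^+ 2 * (cos y / sin y) <=
  x ^+ 2 * (cos x / sin x) + sqrcot_slope x * (y - x).
Proof.
move=> /andP[x0 xp] /andP[y0 yp].
have s_neq0 (u : R) : 0 < u -> u <= pi / 2 -> sin u != 0.
  move=> u0 up; rewrite gt_eqF// sin_gt0_pi// u0/=; have := pi_gt0 R; lra.
have M (u v : R) : 0 < u -> u <= v -> v <= pi / 2 -> exists2 c, u <= c <= v &
    v ^+ 2 * (cos v / sin v) - u ^+ 2 * (cos u / sin u) = sqrcot_slope c * (v - u).
  move=> u0 uv vp.
  have [c|c|c c_in fE] := @MVT_segment R (fun y => y ^+ 2 * (cos y / sin y)) (@sqrcot_slope R) u v uv.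
  - rewrite in_itv /= => /andP[/ltW ac /ltW cb]; apply: is_derive_sqrcot.
    by apply: s_neq0; [exact: lt_le_trans ac|exact: le_trans vp].
  - apply: derivable_within_continuous => z; rewrite in_itv /= => /andP[uz zv].
    apply: (@ex_derive _ _ _ _ _ _ _ (is_derive_sqrcot _)).
    by apply: s_neq0; [exact: lt_le_trans uz|exact: le_trans vp].
  by exists c => //; move: c_in; rewrite in_itv.
have [xy|/ltW yx] := leP x y.
  have [c /andP[xc cy] E] := M _ _ x0 xy yp.
  have := sqrcot_slope_le x0 xc (le_trans cy yp).
  nra.
have [c /andP[yc cx] E] := M _ _ y0 yx xp.
have := sqrcot_slope_le (lt_le_trans y0 yc) cx xp.
nra.
Qed.

(** This is the height at 0 of the tangent at [x]. Its sign covers edges of length zero and lets a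
    polygon with fewer than N edges be compared with the regular N-gon. *)
Lemma sqrcot_tangent_ge0 (R : realType) (x : R) : 0 < x <= pi / 2 ->
  0 <= x ^+ 2 * (cos x / sin x) - sqrcot_slope x * x.
Proof.
move=> /andP[x0 xp]; have pi0 := pi_gt0 R.
have s_gt0 : 0 < sin x by rewrite sin_gt0_pi// x0/=; lra.
have c_ge0 : 0 <= cos x by rewrite cos_ge0_pihalf// xp andbT; lra.
have -> : x ^+ 2 * (cos x / sin x) - sqrcot_slope x * x =
    x ^+ 2 * (x - sin x * cos x) / sin x ^+ 2.
  by rewrite /sqrcot_slope; field; rewrite gt_eqF.
rewrite divr_ge0 ?sqr_ge0// mulr_ge0 ?sqr_ge0// subr_ge0.
have := sin_le_id (ltW x0); have := cos_le1 x; nra.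
Qed.

(** * The isoperimetric inequality for polygons *)

Definition hypot (R : realType) (x y : R) : R := Num.sqrt (x ^+ 2 + y ^+ 2).

Lemma hypot_ge0 (R : realType) (x y : R) : 0 <= hypot x y.
Proof. exact: sqrtr_ge0. Qed.

Lemma sqr_hypot (R : realType) (x y : R) : hypot x y ^+ 2 = x ^+ 2 + y ^+ 2.
Proof. by rewrite sqr_sqrtr// addr_ge0 ?sqr_ge0. Qed.

Lemma hypotN (R : realType) (x y : R) : hypot (- x) (- y) = hypot x y.
Proof. by rewrite /hypot !sqrrN. Qed.

Lemma hypot_eq0 (R : realType) (x y : R) : hypot x y = 0 -> x = 0 /\ y = 0.
Proof.
move=> h0; have := sqr_hypot x y; rewrite h0 expr0n /= => /esym/eqP.
by rewrite paddr_eq0 ?sqr_ge0// !sqrf_eq0 => /andP[/eqP-> /eqP->].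
Qed.

Lemma cross_le_hypot (R : realType) (x y u v : R) :
  `|x * v - y * u| <= hypot x y * hypot u v.
Proof.
rewrite -ler_sqr ?nnegrE ?mulr_ge0 ?hypot_ge0//.
rewrite exprMn !sqr_hypot real_normK ?num_real// -subr_ge0.
by rewrite [leRHS](_ : _ = (x * u + y * v) ^+ 2) ?sqr_ge0//; ring.
Qed.

Lemma hypotD (R : realType) (x y u v : R) :
  hypot (x + u) (y + v) <= hypot x y + hypot u v.
Proof.
rewrite -ler_sqr ?nnegrE ?addr_ge0 ?hypot_ge0// sqrrD !sqr_hypot.
(* Turning the second vector by a right angle makes the cross product an inner product, which gives
   Cauchy-Schwarz. *)
have := cross_le_hypot x y (- v) u; rewrite ler_norml => /andP[_].
have -> : hypot (- v) u = hypot u v by rewrite /hypot sqrrN addrC.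
by move=> h; lra.
Qed.

Lemma hypot_sum (R : realType) (I : Type) (r : seq I) (P : pred I) (F G : I -> R) :
  hypot (\sum_(i <- r | P i) F i) (\sum_(i <- r | P i) G i) <=
  \sum_(i <- r | P i) hypot (F i) (G i).
Proof.
elim/big_rec3: _ => [|i x y z _ IH].
  by rewrite /hypot expr0n /= addr0 sqrtr0.
by apply: le_trans (hypotD _ _ _ _) _; rewrite lerD2l.
Qed.

(* After clearing denominators the difference of the two sides is a sum of two
   squares: the first vector, scaled by sin s, minus the second one, scaled by
   sin r and rotated by the angle r + s. *)
Lemma cot_merge (R : realType) (r s x y u v : R) : 0 < r -> 0 < s -> r + s < pi ->
  cos (r + s) / sin (r + s) * ((x + u) ^+ 2 + (y + v) ^+ 2) +
    2 * (x * v - y * u) <=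
  cos r / sin r * (x ^+ 2 + y ^+ 2) + cos s / sin s * (u ^+ 2 + v ^+ 2).
Proof.
move=> r0 s0 rs.
have Sr : 0 < sin r by rewrite sin_gt0_pi// r0/=; lra.
have Ss : 0 < sin s by rewrite sin_gt0_pi// s0/=; lra.
have Srs : 0 < sin (r + s) by rewrite sin_gt0_pi// addr_gt0/=.
rewrite -subr_ge0.
set C := cos (r + s); set S := sin (r + s).
have E : cos r / sin r * (x ^+ 2 + y ^+ 2) + cos s / sin s * (u ^+ 2 + v ^+ 2) -
    (C / S * ((x + u) ^+ 2 + (y + v) ^+ 2) + 2 * (x * v - y * u)) =
   ((sin s * x - sin r * (C * u + S * v)) ^+ 2 +
    (sin s * y - sin r * (C * v - S * u)) ^+ 2) / (S * sin r * sin s).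
  rewrite /C /S cosD sinD in Srs *.
  field: (cos2sin2 r) (cos2sin2 s).
  by rewrite !gt_eqF.
rewrite E divr_ge0// ?addr_ge0 ?sqr_ge0//.
by rewrite ltW// !mulr_gt0.
Qed.

(** * Paths in the plane and the area enclosed by closed ones *)

Section Polygon.
Variables (R : realType) (X Y : nat -> R).

Let len i := hypot (X i - X i.+1) (Y i - Y i.+1).
Let cross i := X i * Y i.+1 - X i.+1 * Y i.
Let cot (x : R) := cos x / sin x.

Let len_eq0 i : len i = 0 -> X i.+1 = X i /\ Y i.+1 = Y i.
Proof. by move=> /hypot_eq0[/subr0_eq-> /subr0_eq->]. Qed.

Let len_ge0 i : 0 <= len i.
Proof. exact: hypot_ge0. Qed.

Let sqr_len i : len i ^+ 2 = (X i.+1 - X i) ^+ 2 + (Y i.+1 - Y i) ^+ 2.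
Proof. by rewrite sqr_hypot; ring. Qed.

Lemma chord_le_path n : hypot (X n - X 0%N) (Y n - Y 0%N) <= \sum_(i < n) len i.
Proof.
rewrite -!telescope_sumr// !big_mkord.
apply: le_trans (hypot_sum _ _ _ _) _; apply: ler_sum => i _.
by rewrite -hypotN !opprB.
Qed.

(** The path so far is replaced by its chord, which carries the angle of the whole length travelled,
    and [cot_merge] adds one edge at a time. *)
Lemma open_path_cot (k : R) n : 0 < k -> k * (\sum_(i < n) len i) < pi ->
  cot (k * \sum_(i < n) len i) * ((X n - X 0%N) ^+ 2 + (Y n - Y 0%N) ^+ 2) -
    2 * (X 0%N * Y n - X n * Y 0%N) <=
  \sum_(i < n) (cot (k * len i) * len i ^+ 2 - 2 * cross i).
Proof.
move=> k0; elim: n => [|n IH].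
  by move=> _; rewrite !big_ord0 le_eqVlt; apply/orP; left; apply/eqP; ring.
rewrite !big_ord_recr /=; have := chord_le_path n.
set L := \sum_(i < n) len i in IH *; set T := \sum_(i < n) _ in IH *.
move=> chord; have L_ge0 : 0 <= L by apply: le_trans chord; exact: hypot_ge0.
(* A new edge or an initial path of length zero is treated apart, since [cot_merge] asks for
   positive angles. *)
have [l0|l0] := eqVneq (len n) 0.
  have [XE YE] := len_eq0 l0; rewrite l0 addr0 /cross XE YE => /IH h.
  by apply: le_trans h _; rewrite le_eqVlt; apply/orP; left; apply/eqP; ring.
have ln0 : 0 < len n by rewrite lt0r l0 len_ge0.
have [L0|L0] := eqVneq L 0.
  have /hypot_eq0[/subr0_eq Xn /subr0_eq Yn] : hypot (X n - X 0%N) (Y n - Y 0%N) = 0.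
    by apply/eqP; rewrite eq_le hypot_ge0 andbT -L0.
  move: IH; rewrite L0 add0r mulr0 Xn Yn => /(_ (pi_gt0 R)) h _.
  rewrite sqr_len /cross Xn Yn; lra.
rewrite mulrDr => lt_pi.
have kL : 0 < k * L by rewrite mulr_gt0// lt0r L0.
have kl : 0 < k * len n by rewrite mulr_gt0.
have lt_pi' : k * L < pi by lra.
have := cot_merge (X n - X 0%N) (Y n - Y 0%N) (X n.+1 - X n) (Y n.+1 - Y n) kL kl lt_pi.
have := IH lt_pi'; rewrite sqr_len /cross /cot.
rewrite (addrC (X n - _)) (addrC (Y n - _)) !subrKA.
lra.
Qed.

(** The last edge is the reversed chord of the open path before it, and their angles add up to pi,
    so the cotangents are opposite and everything cancels. The induction only strips final edges of
    length zero. *)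
Lemma closed_path_cot (k : R) n : 0 < k -> X n = X 0%N -> Y n = Y 0%N ->
  k * (\sum_(i < n) len i) = pi ->
  0 <= \sum_(i < n) (cot (k * len i) * len i ^+ 2 - 2 * cross i).
Proof.
move=> k0; elim: n => [|n IH].
  by rewrite !big_ord0 mulr0 => _ _ /eqP; rewrite lt_eqF ?pi_gt0.
move=> XE YE; rewrite !big_ord_recr /=.
have [l0|l0] := eqVneq (len n) 0.
  have [XE' YE'] := len_eq0 l0; rewrite l0 addr0 => /IH h.
  rewrite /cross XE' YE' (_ : _ - 2 * _ = 0); last by ring.
  by rewrite addr0 h -?XE' -?YE'.
have ln0 : 0 < len n by rewrite lt0r l0 len_ge0.
rewrite mulrDr => pE; have kl : 0 < k * len n by rewrite mulr_gt0.
have lt_pi : k * (\sum_(i < n) len i) < pi by lra.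
have := open_path_cot k0 lt_pi.
have -> : k * (\sum_(i < n) len i) = pi - k * len n by lra.
rewrite /cot sinB cosB sinpi cospi !mul0r addr0 sub0r !mulN1r opprK.
rewrite sqr_len /cross XE YE; lra.
Qed.

(** The remaining edges join the same two endpoints. Once the perimeter is scaled to pi, every edge
    angle is at most pi / 2, where x^2 cot x is concave. *)
Lemma edge_le_half_perimeter n j : X n = X 0%N -> Y n = Y 0%N -> (j < n)%N ->
  2 * len j <= \sum_(i < n) len i.
Proof.
move=> XE YE jn; pose i0 := Ordinal jn.
have sum0 (F : nat -> R) : F n = F 0%N ->
    F j - F j.+1 = \sum_(i < n | i != i0) - (F i - F i.+1).
  move=> FE; have : \sum_(0 <= i < n) (F i.+1 - F i) = 0.
    by rewrite telescope_sumr// FE subrr.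
  rewrite big_mkord (bigD1 i0)//= => /eqP; rewrite addr_eq0 => /eqP E.
  rewrite -[LHS]opprB E opprK; apply: eq_bigr => i _; by rewrite opprB.
rewrite (bigD1 i0)//= mulr2n mulrDl !mul1r lerD2l /len (sum0 X XE) (sum0 Y YE).
apply: le_trans (hypot_sum _ _ _ _) _; apply: ler_sum => i _.
by rewrite hypotN.
Qed.

Lemma polygon_isoperimetric N n : (2 <= N)%N -> (n <= N)%N ->
  X n = X 0%N -> Y n = Y 0%N ->
  \sum_(i < n) cross i <= (\sum_(i < n) len i) ^+ 2 / (2 * N%:R * tan (pi / N%:R)).
Proof.
move=> N_ge2 nN XE YE; set L := \sum_(i < n) len i.
have L_ge0 : 0 <= L by rewrite sumr_ge0.
have [L0|L0] := eqVneq L 0.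
  rewrite L0 expr0n /= mul0r sumr_le0// => i _.
  have /len_eq0[Xi Yi] : len i = 0.
    apply/eqP; have := psumr_eq0P (P := xpredT) (fun (i : 'I_n) _ => len_ge0 i) L0.
    by move=> ->.
  by rewrite /cross Xi Yi mulrC subrr.
have L_gt0 : 0 < L by rewrite lt0r L0.
have pi0 := pi_gt0 R.
have N0 : 0 < N%:R :> R by rewrite ltr0n; case: (N) N_ge2.
have N2 : 2 <= N%:R :> R by rewrite ler_nat.
(* With this scaling the edge angles add up to pi; [x] below is the edge angle of the regular N-gon,
   where the tangent is taken. *)
pose k := pi / L; have k0 : 0 < k by rewrite divr_gt0.
pose x : R := pi / N%:R; have x0 : 0 < x by rewrite divr_gt0.
have x_le : x <= pi / 2 by rewrite ler_pM2l// lef_pV2 ?posrE.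
have kL : k * L = pi by rewrite /k mulfVK.
have := closed_path_cot k0 XE YE kL.
rewrite sumrB -mulr_sumr subr_ge0 => h.
set A := x ^+ 2 * cot x - sqrcot_slope x * x.
have A_ge0 : 0 <= A by apply: sqrcot_tangent_ge0; rewrite x0.
have tangent i : (i < n)%N -> cot (k * len i) * len i ^+ 2 <=
    k ^- 2 * (A + sqrcot_slope x * (k * len i)).
  move=> i_lt; rewrite ler_pdivlMl ?exprn_gt0// mulrCA mulrC -exprMn.
  have [->|l0] := eqVneq (len i) 0.
    by rewrite !mulr0 expr0n /= mul0r addr0.
  have l_gt0 : 0 < len i by rewrite lt0r l0 len_ge0.
  have := @sqrcot_le_tangent R x (k * len i).
  rewrite x0 x_le mulr_gt0//= => /(_ isT) tan_le.
  have := edge_le_half_perimeter XE YE i_lt => half.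
  apply: le_trans (tan_le _) _.
    by rewrite -kL -mulrA ler_pM2l// ler_pdivlMr// mulrC.
  by rewrite /A /cot; lra.
have : \sum_(i < n) cot (k * len i) * len i ^+ 2 <= k ^- 2 * (N%:R * (x ^+ 2 * cot x)).
  apply: le_trans (ler_sum _ (fun (i : 'I_n) _ => tangent i (ltn_ord i))) _.
  rewrite -mulr_sumr ler_pM2l ?invr_gt0 ?exprn_gt0// big_split /= sumr_const card_ord.
  rewrite -mulr_sumr -mulr_sumr -/L kL -(mulr_natl A).
  have -> : N%:R * (x ^+ 2 * cot x) = N%:R * A + sqrcot_slope x * pi.
    by rewrite /A /x; field; rewrite gt_eqF.
  by rewrite lerD2r ler_wpM2r// ler_nat.
have -> : k ^- 2 * (N%:R * (x ^+ 2 * cot x)) = 2 * (L ^+ 2 / (2 * N%:R * tan (pi / N%:R))).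
  (* If [cos x = 0], as for N = 2, both sides are 0 by the convention [0^-1 = 0]. *)
  rewrite -/x /tan /cot; case: (eqVneq (cos x) 0) => [->|c0].
    by rewrite !mul0r invr0 !mulr0 invr0 !mulr0.
  have sx : sin x != 0 by rewrite gt_eqF// sin_gt0_pi// x0/=; lra.
  move: (cos x) (sin x) c0 sx => c s c0 s0.
  rewrite /k /x; move: (@pi R) (lt0r_neq0 pi0) => p p0; field.
  by rewrite c0 s0 L0 p0 (gt_eqF N0).
move=> h'; have := le_trans h h'; rewrite ler_pM2l//.
Qed.

End Polygon.

(** * Logarithmic inequalities *)

(** After division by r + 1 the claim is ln r + 4 / (r + 1) >= 2. Equality holds at 1, and the left
    side has derivative (x - 1)^2 / (x (x + 1)^2). *)
Lemma ln_ge_two_sub_div_add (R : realType) (r : R) : 1 <= r ->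
  2 * (r - 1) <= (r + 1) * ln r.
Proof.
move=> r1; have := @is_derive_ge0_le R (fun x => ln x + 4 * (x + 1)^-1)
  (fun x => x^-1 - 4 * (x + 1) ^- 2) 1 r r1.
rewrite ln1 (_ : 0 + 4 * (1 + 1)^-1 = 2); last by field.
move=> /(_ _ _) h; rewrite -subr_ge0.
have : 2 <= ln r + 4 * (r + 1)^-1.
  apply: h => x /andP[x1 _]; have x0 : 0 < x by lra.
    have ? : x + 1 != 0 by lra.
    have dln := is_derive1_ln x0.
    apply: is_derive_eq; rewrite /GRing.scale /=; field. by apply/andP; split => //; rewrite gt_eqF.
  have -> : x^-1 - 4 * (x + 1) ^- 2 = (x - 1) ^+ 2 / (x * (x + 1) ^+ 2).
    by field; apply/andP; split; lra.
  by rewrite divr_ge0 ?sqr_ge0// mulr_ge0 ?sqr_ge0 ?ltW.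
move=> h'; have -> : (r + 1) * ln r - 2 * (r - 1) =
    (r + 1) * (ln r + 4 * (r + 1)^-1 - 2) by field; lra.
by rewrite mulr_ge0; lra.
Qed.

(** The logarithm is bounded below through 2 (u - v)^2 / (u + v), which is the maximum over [y] of
    the quadratic, attained at (u - v) / (u + v). *)
Lemma log_ratio_quadratic (R : realType) (u v y : R) : 0 < u -> 0 < v ->
  4 * (u - v) * y - 2 * (u + v) * y ^+ 2 <= (u - v) * ln (u / v).
Proof.
move=> u0 v0; wlog uv : u v y u0 v0 / v <= u.
  move=> H; case: (leP v u) => [|/ltW uv]; first exact: H.
  have := H v u (- y) v0 u0 uv.
  by rewrite -[v / u]invf_div lnV ?posrE ?divr_gt0//; lra.
have r1 : 1 <= u / v by rewrite ler_pdivlMr// mul1r.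
have := ln_ge_two_sub_div_add r1.
have -> : 2 * (u / v - 1) = 2 * (u - v) / v by field; lra.
have -> : (u / v + 1) * ln (u / v) = (u + v) * ln (u / v) / v by field; lra.
rewrite ler_pM2r ?invr_gt0// => h.
have uv0 : 0 < u + v by rewrite addr_gt0.
rewrite -(ler_pM2l uv0).
have := ler_wpM2l (_ : 0 <= u - v) h; rewrite subr_ge0 => /(_ uv).
have := sqr_ge0 ((u - v) - (u + v) * y).
lra.
Qed.

(** A minorant linear in [x] and [y] that touches where x / y = k; it comes from ln z <= z - 1 at z
    = k y / x. *)
Lemma ln_ratio_tangent (R : realType) (k x y : R) : 0 < k -> 0 <= x -> 0 <= y ->
  (0 < x -> 0 < y) -> x * (1 + ln k) - k * y <= x * ln (x / y).
Proof.
move=> k0 x_ge0 y_ge0 xy.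
have [->|x_neq0] := eqVneq x 0; first by rewrite !mul0r sub0r oppr_le0 mulr_ge0// ltW.
have x0 : 0 < x by rewrite lt0r x_neq0.
have y0 := xy x0.
have z0 : 0 < k * y / x by rewrite divr_gt0// mulr_gt0.
have := @le_ln1Dx R (k * y / x - 1).
rewrite ltrBrDl addrN z0 addrC subrK => /(_ isT).
have -> : k * y / x = k / (x / y) by field; lra.
rewrite ln_div ?posrE ?divr_gt0// -(ler_pM2l x0).
have -> : x * (k / (x / y) - 1) = k * y - x by field; lra.
lra.
Qed.

(** Taken at the ratio of the two totals, the linear minorants add up exactly to the left side. *)
Lemma log_sum (R : realType) (I : finType) (x y : I -> R) :
  (forall i, 0 <= x i) -> (forall i, 0 <= y i) -> (forall i, 0 < x i -> 0 < y i) ->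
  (\sum_i x i) * ln ((\sum_i x i) / \sum_i y i) <= \sum_i x i * ln (x i / y i).
Proof.
move=> x_ge0 y_ge0 xy; set X := \sum_i x i; set Y := \sum_i y i.
have [X0|X_neq0] := eqVneq X 0.
  rewrite X0 mul0r sumr_ge0// => i _.
  by rewrite (psumr_eq0P (fun i _ => x_ge0 i) X0)// mul0r.
have [i xi|x0] := pickP (fun i => 0 < x i); last first.
  move: X_neq0; rewrite /X big1 ?eqxx// => i _.
  by apply/eqP; rewrite eq_le x_ge0 andbT leNgt x0.
have X0 : 0 < X by rewrite lt0r X_neq0 sumr_ge0.
have Y0 : 0 < Y.
  by rewrite /Y (bigD1 i)//= ltr_pwDl ?xy// sumr_ge0.
have XY0 : 0 < X / Y by rewrite divr_gt0.
have -> : X * ln (X / Y) = \sum_i (x i * (1 + ln (X / Y)) - X / Y * y i).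
  rewrite sumrB -mulr_suml -mulr_sumr -/X -/Y; field; lra.
by apply: ler_sum => j _; apply: ln_ratio_tangent => //; apply: xy.
Qed.

(** * Relative entropy of a stationary kernel and its reversal *)

Section RelativeEntropy.
Variables (R : realType) (N : nat).
Implicit Types (Q W : 'M[R]_N) (p : 'cV[R]_N).

(* Q m n is the probability of a transition from n to m; the last field makes
   the relative entropy below meaningful when p or Q has zero entries. *)
Definition stationary_kernel Q p : Prop :=
  [/\ forall m n, 0 <= Q m n,
      forall n, \sum_m Q m n = 1,
      Q *m p = p &
      forall m n, 0 < Q m n * p n 0 -> 0 < Q n m * p m 0].

(* The Kullback-Leibler divergence between the law of a stationary transition
   and the law of its time reversal. *)
Definition reversal_entropy Q p : R :=
  \sum_m \sum_n Q m n * p n 0 * ln ((Q m n * p n 0) / (Q n m * p m 0)).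

Lemma stationary_kernel1 p : (forall n, 0 <= p n 0) -> stationary_kernel 1%:M p.
Proof.
move=> p_ge0; split.
- by move=> m n; rewrite mxE.
- move=> n; rewrite (bigD1 n)//= mxE eqxx big1 ?addr0// => m /negPf nm.
  by rewrite mxE nm.
- by rewrite mul1mx.
- move=> m n; rewrite !mxE (eq_sym n); have [->//|] := eqVneq m n.
  by rewrite !mul0r.
Qed.

Lemma reversal_entropy1 p : reversal_entropy 1%:M p = 0.
Proof.
apply: big1 => m _; apply: big1 => n _; rewrite !mxE (eq_sym n).
have [->|] := eqVneq m n; last by rewrite !mul0r.
have [->|p0] := eqVneq (p n 0) 0; first by rewrite mulr0 mul0r.
by rewrite mul1r divff// ln1 mulr0.
Qed.

(** * Products of two commuting kernels *)

Section Product.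
Variables (Q1 Q2 : 'M[R]_N) (p : 'cV[R]_N).
Hypotheses (p_ge0 : forall n, 0 <= p n 0)
  (Q1_kernel : stationary_kernel Q1 p) (Q2_kernel : stationary_kernel Q2 p)
  (commQ : Q1 *m Q2 = Q2 *m Q1).

(** Weights of the path n -> k -> m and of its reversal m -> k -> n. Reversal exchanges the order of
    the two kernels, and commutation makes the reversed paths add up to the same product kernel. *)
Let fwd m n k := Q1 m k * (Q2 k n * p n 0).
Let bwd m n k := Q2 n k * (Q1 k m * p m 0).

Let fwd_sum m n : (Q1 *m Q2) m n * p n 0 = \sum_k fwd m n k.
Proof. by rewrite mxE mulr_suml; apply: eq_bigr => k _; rewrite -mulrA. Qed.

Let bwd_sum m n : (Q1 *m Q2) n m * p m 0 = \sum_k bwd m n k.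
Proof. by rewrite commQ mxE mulr_suml; apply: eq_bigr => k _; rewrite -mulrA. Qed.

Let fwd_ge0 m n k : 0 <= fwd m n k.
Proof.
by case: Q1_kernel Q2_kernel => [h1 _ _ _] [h2 _ _ _]; rewrite !mulr_ge0.
Qed.

Let bwd_ge0 m n k : 0 <= bwd m n k.
Proof.
by case: Q1_kernel Q2_kernel => [h1 _ _ _] [h2 _ _ _]; rewrite !mulr_ge0.
Qed.

Let fwd_pos m n k : 0 < fwd m n k ->
  [/\ 0 < Q1 m k, 0 < p k 0, 0 < Q2 k n * p n 0, 0 < Q2 n k & 0 < Q1 k m * p m 0].
Proof.
case: Q1_kernel Q2_kernel => [ge1 _ _ rev1] [ge2 _ _ rev2] x0.
have pos (x y : R) : 0 <= x -> 0 <= y -> 0 < x * y -> 0 < x /\ 0 < y.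
  move=> x_ge0 y_ge0 xy; rewrite !lt0r x_ge0 y_ge0 !andbT.
  by apply/andP; rewrite -negb_or -mulf_eq0 gt_eqF.
have [Q1mk Q2kn] := pos _ _ (ge1 _ _) (mulr_ge0 (ge2 _ _) (p_ge0 _)) x0.
have [Q2nk pk] := pos _ _ (ge2 _ _) (p_ge0 _) (rev2 _ _ Q2kn).
by split => //; apply: rev1; rewrite mulr_gt0.
Qed.

Let fwd_bwd m n k : 0 < fwd m n k -> 0 < bwd m n k.
Proof. by move=> /fwd_pos[? ? ? ? ?]; rewrite mulr_gt0. Qed.

Lemma stationary_kernelM : stationary_kernel (Q1 *m Q2) p.
Proof.
case: (Q1_kernel) (Q2_kernel) => [ge1 col1 st1 rev1] [ge2 col2 st2 rev2]; split.
- by move=> m n; rewrite mxE sumr_ge0// => k _; rewrite mulr_ge0.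
- move=> n; under eq_bigr do rewrite mxE.
  rewrite exchange_big /= -[RHS](col2 n); apply: eq_bigr => k _.
  by rewrite -mulr_suml col1 mul1r.
- by rewrite -mulmxA st2 st1.
- move=> m n; rewrite fwd_sum bwd_sum => x0.
  have [k xk|x_le0] := pickP (fun k => 0 < fwd m n k).
    rewrite (bigD1 k)//= ltr_pwDl ?fwd_bwd// sumr_ge0// => *; exact: bwd_ge0.
  move: x0; rewrite lt_neqAle => /andP[/negP[]]; rewrite big1// => k _.
  by apply/eqP; rewrite eq_le fwd_ge0 andbT leNgt x_le0.
Qed.

(** The log-sum inequality forgets the intermediate state [k]. For a whole path the log ratio splits
    into one term per step once [p k 0] is inserted above and below. Summing out the free endpoint
    uses stationarity of [Q2] for the first step of the path and column sums of [Q1] for the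
    other. *)
Lemma reversal_entropyM :
  reversal_entropy (Q1 *m Q2) p <= reversal_entropy Q1 p + reversal_entropy Q2 p.
Proof.
case: (Q1_kernel) (Q2_kernel) => [ge1 col1 st1 rev1] [ge2 col2 st2 rev2].
pose l1 m k := ln ((Q1 m k * p k 0) / (Q1 k m * p m 0)).
pose l2 k n := ln ((Q2 k n * p n 0) / (Q2 n k * p k 0)).
have step m n : (Q1 *m Q2) m n * p n 0 *
    ln ((Q1 *m Q2) m n * p n 0 / ((Q1 *m Q2) n m * p m 0)) <=
    \sum_k fwd m n k * (l1 m k + l2 k n).
  rewrite fwd_sum bwd_sum; apply: le_trans (log_sum _ _ _) _ => //.
  - exact: fwd_bwd.
  apply: ler_sum => k _; have [->|x_neq0] := eqVneq (fwd m n k) 0; first by rewrite !mul0r.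
  have x0 : 0 < fwd m n k by rewrite lt0r x_neq0 fwd_ge0.
  have [Q1mk pk Q2kn Q2nk Q1km] := fwd_pos x0.
  have r1 : 0 < Q1 m k * p k 0 / (Q1 k m * p m 0) by rewrite divr_gt0// mulr_gt0.
  have r2 : 0 < Q2 k n * p n 0 / (Q2 n k * p k 0) by rewrite divr_gt0// mulr_gt0.
  rewrite ler_pM2l// /l1 /l2 -lnM ?posrE//.
  rewrite le_eqVlt; apply/orP; left; apply/eqP; congr ln.
  have := lt0r_neq0 Q1km; rewrite mulf_eq0 negb_or => /andP[Q1km_neq0 pm_neq0].
  by rewrite /fwd /bwd; field; rewrite pm_neq0 Q1km_neq0 !gt_eqF.
apply: le_trans (ler_sum _ (fun m _ => ler_sum _ (fun n _ => step m n))) _.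
have -> : \sum_m \sum_n \sum_k fwd m n k * (l1 m k + l2 k n) =
    (\sum_m \sum_k Q1 m k * l1 m k * \sum_n Q2 k n * p n 0) +
    \sum_k \sum_n (Q2 k n * p n 0 * l2 k n) * \sum_m Q1 m k.
  have -> : \sum_k \sum_n (Q2 k n * p n 0 * l2 k n) * \sum_m Q1 m k =
      \sum_m \sum_k \sum_n fwd m n k * l2 k n.
    under eq_bigr do under eq_bigr do rewrite mulr_sumr.
    rewrite exchange_big /=; rewrite [RHS]exchange_big /=.
    rewrite exchange_big /=; apply: eq_bigr => k _.
    rewrite exchange_big /=; apply: eq_bigr => m _; apply: eq_bigr => n _.
    by rewrite /fwd; ring.
  rewrite -big_split /=; apply: eq_bigr => m _.
  rewrite exchange_big -big_split /=; apply: eq_bigr => k _.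
  rewrite mulr_sumr -big_split /=; apply: eq_bigr => n _; rewrite /fwd; ring.
rewrite lerD//.
  apply: ler_sum => m _; apply: ler_sum => k _.
  have := congr1 (fun v : 'cV_N => v k 0) st2; rewrite mxE => ->.
  by rewrite mulrAC.
by apply: ler_sum => k _; apply: ler_sum => n _; rewrite col1 mulr1.
Qed.

End Product.

Lemma stationary_kernelX Q p k : (forall n, 0 <= p n 0) -> stationary_kernel Q p ->
  stationary_kernel (Q ^+ k) p /\
  reversal_entropy (Q ^+ k) p <= k%:R * reversal_entropy Q p.
Proof.
move=> p_ge0 Qk; elim: k => [|k [IH1 IH2]].
  rewrite expr0 mul0r -[1]/(1%:M) reversal_entropy1; split => //.
  exact: stationary_kernel1.
have comm : Q *m Q ^+ k = Q ^+ k *m Q by exact: etrans (esym (exprS Q k)) (exprSr Q k).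
rewrite exprS -[Q * _]/(Q *m _); split; first exact: stationary_kernelM.
apply: le_trans (reversal_entropyM p_ge0 Qk IH1 comm) _.
by rewrite mulrS mulrDl mul1r lerD2l.
Qed.

(** Pairing (m, n) with (n, m) on both sides reduces the claim to [log_ratio_quadratic]; pairs of
    weight zero vanish together because the support is symmetric. *)
Lemma reversal_entropy_quadratic Q p (y : 'I_N -> 'I_N -> R) :
  (forall n, 0 <= p n 0) -> stationary_kernel Q p ->
  (forall m n, y n m = - y m n) ->
  4 * (\sum_m \sum_n Q m n * p n 0 * y m n) -
    2 * (\sum_m \sum_n Q m n * p n 0 * y m n ^+ 2) <= reversal_entropy Q p.
Proof.
move=> p_ge0 [ge0 _ _ rev] y_anti; pose A m n := Q m n * p n 0.
pose l m n := ln (A m n / A n m).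
have sym (F : 'I_N -> 'I_N -> R) : 2 * (\sum_m \sum_n F m n) =
    \sum_m \sum_n (F m n + F n m).
  rewrite mulr2n mulrDl mul1r {2}exchange_big -big_split /=.
  by apply: eq_bigr => m _; rewrite big_split.
have -> : 4 * (\sum_m \sum_n Q m n * p n 0 * y m n) -
    2 * (\sum_m \sum_n Q m n * p n 0 * y m n ^+ 2) =
    \sum_m \sum_n (4 * (A m n * y m n) - 2 * (A m n * y m n ^+ 2)).
  rewrite !mulr_sumr -sumrB; apply: eq_bigr => m _.
  by rewrite !mulr_sumr -sumrB.
rewrite -(ler_pM2l (_ : 0 < 2))// /reversal_entropy !sym.
apply: ler_sum => m _; apply: ler_sum => n _.
rewrite -/(A m n) -/(A n m) (y_anti m n).
have A_ge0 i j : 0 <= A i j by rewrite mulr_ge0.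
have [A0|A0] := eqVneq (A m n) 0.
  have -> : A n m = 0.
    apply/eqP; rewrite eq_le A_ge0 andbT leNgt; apply/negP => /rev.
    by rewrite -/(A m n) A0 ltxx.
  by rewrite A0 !mul0r !addr0 !mulr0 subrr.
have Amn : 0 < A m n by rewrite lt0r A0 A_ge0.
have Anm : 0 < A n m by exact: rev.
have := log_ratio_quadratic (y m n) Amn Anm.
rewrite -[A n m / A m n]invf_div lnV ?posrE ?divr_gt0//.
lra.
Qed.

(** Diagonal terms have log ratio 0, and off the diagonal the factor [h] cancels inside the
    logarithm, so the entropy is exactly linear in [h]. *)
Lemma euler_kernel W p (h : R) : jump_rate_matrix W -> local_detailed_balance W ->
  steady_state W p -> 0 < h -> (forall n, 0 <= 1 + h * W n n) ->
  stationary_kernel (1%:M + h *: W) p /\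
  reversal_entropy (1%:M + h *: W) p = h * entropy_production W p.
Proof.
move=> [rate_ge0 diagE] ldb [p_ge0 p_sum Wp] h0 diag_ge0.
pose a m n := W m n * p n 0.
have a_rev m n : m != n -> 0 < a m n -> 0 < a n m.
  move=> mn; rewrite /a => amn.
  have [Wmn pn] : 0 < W m n /\ 0 < p n 0.
    rewrite !lt0r rate_ge0// p_ge0 !andbT; apply/andP.
    by rewrite -negb_or -mulf_eq0 gt_eqF.
  rewrite mulr_gt0//; first by apply/(ldb m n mn).
  (* If state [m] had probability 0, its stationarity equation would be a vanishing sum of
     nonnegative inflows, one of which is the positive [W m n * p n 0]. *)
  rewrite lt0r p_ge0 andbT; apply/eqP => pm0.
  have := congr1 (fun v : 'cV_N => v m 0) Wp; rewrite !mxE => /eqP.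
  rewrite (bigD1 m)//= pm0 mulr0 add0r psumr_eq0 => [|k km]; last first.
    by rewrite mulr_ge0// rate_ge0// eq_sym.
  move=> /allP/(_ n (mem_index_enum _)); rewrite eq_sym mn /= => /eqP E.
  by rewrite E ltxx in amn.
have offdiag m n : m != n -> (1%:M + h *: W) m n = h * W m n.
  by move=> mn; rewrite !mxE (negPf mn) add0r.
have diag n : (1%:M + h *: W) n n = 1 + h * W n n by rewrite !mxE eqxx.
split.
  split.
  - move=> m n; have [->|mn] := eqVneq m n; first by rewrite diag.
    by rewrite offdiag// mulr_ge0 ?rate_ge0// ltW.
  - move=> n; rewrite (bigD1 n)//= diag diagE.
    under eq_bigr => m mn do rewrite offdiag//.
    by rewrite -mulr_sumr mulrN subrK.
  - by rewrite mulmxDl mul1mx -scalemxAl Wp scaler0 addr0.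
  - move=> m n; have [->//|mn] := eqVneq m n.
    by rewrite !offdiag// 1?eq_sym// -!mulrA !(pmulr_rgt0 _ h0); exact: (a_rev m n mn).
pose f m n := a m n * ln (a m n / a n m).
have -> : reversal_entropy (1%:M + h *: W) p = h * \sum_m \sum_(n | n != m) f m n.
  rewrite mulr_sumr; apply: eq_bigr => m _.
  rewrite (bigD1 m)//= (_ : _ * ln _ = 0) ?add0r; last first.
    set u := _ * p m 0; have [->|u0] := eqVneq u 0; first by rewrite mul0r.
    by rewrite divff// ln1 mulr0.
  rewrite mulr_sumr; apply: eq_bigr => n nm.
  have mn : m != n by rewrite eq_sym.
  have -> : (1%:M + h *: W) m n * p n 0 = h * a m n by rewrite offdiag// mulrA.
  have -> : (1%:M + h *: W) n m * p m 0 = h * a n m by rewrite offdiag// mulrA.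
  by rewrite /f -mulf_div divff ?gt_eqF// mul1r !mulrA.
congr (_ * _); rewrite /entropy_production.
have split_lt m : \sum_(n | n != m) f m n =
    \sum_(n < N | (n < m)%N) f m n + \sum_(n < N | (m < n)%N) f m n.
  rewrite (bigID (fun n : 'I_N => (n < m)%N)) /=; congr (_ + _); apply: eq_bigl => n.
    by rewrite -val_eqE /=; case: ltngtP.
  by rewrite -val_eqE /= -leqNgt; case: ltngtP.
under eq_bigr do rewrite split_lt.
rewrite big_split /= (exchange_big_dep predT)//= -big_split /=.
apply: eq_bigr => n _; rewrite -big_split /=; apply: eq_bigr => m nm.
have mn : m != n by rewrite -val_eqE /= gtn_eqF.
rewrite -/(a m n) -/(a n m) /f.
have [A0|A0] := eqVneq (a m n) 0.
  have -> : a n m = 0.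
    apply/eqP; rewrite eq_le mulr_ge0 ?rate_ge0// 1?eq_sym// andbT leNgt.
    by apply/negP => /a_rev; rewrite A0 ltxx => H; have := H _; rewrite eq_sym mn => /(_ isT).
  by rewrite A0 !mul0r !addr0 subrr mul0r.
have Amn : 0 < a m n by rewrite lt0r A0 mulr_ge0// rate_ge0.
have Anm : 0 < a n m by exact: (a_rev m n mn).
rewrite -[a n m / a m n]invf_div lnV ?posrE ?divr_gt0//; ring.
Qed.

End RelativeEntropy.

(** * Euler approximation of the matrix exponential *)

Section MatrixExponential.
Variables (R : realType) (N : nat).
Implicit Types A : 'M[R]_N.

Lemma mxpow_entry_bound A : exists2 M : R, 0 <= M &
  forall k i j, `|(A ^+ k) i j| <= M ^+ k.
Proof.
exists (\sum_i \sum_j `|A i j|).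
  by apply: sumr_ge0 => i _; apply: sumr_ge0.
set M := \sum_i _; have M_ge0 : 0 <= M by apply: sumr_ge0 => i _; apply: sumr_ge0.
elim=> [|k IH] i j.
  rewrite !expr0 -[1]/(1%:M) mxE; case: eqP => _; by rewrite ?normr1 ?normr0.
rewrite exprS -[A * _]/(A *m _) mxE exprS.
apply: le_trans (ler_norm_sum _ _ _) _.
apply: (@le_trans _ _ (\sum_l `|A i l| * M ^+ k)).
  by apply: ler_sum => l _; rewrite normrM ler_wpM2l.
rewrite -mulr_suml ler_wpM2r ?exprn_ge0// /M [leRHS](bigD1 i)//= lerDl.
by apply: sumr_ge0 => l _; apply: sumr_ge0.
Qed.

Let expmx_series A := series (fun k : nat => (k`!%:R)^-1 *: (A ^+ k)).

Lemma expmx_series_entry A n i j :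
  expmx_series A n i j = \sum_(k < n) (k`!%:R)^-1 * (A ^+ k) i j.
Proof.
by rewrite /expmx_series /series /= big_mkord summxE; apply: eq_bigr => k _; rewrite mxE.
Qed.

Lemma is_cvg_expmx_series_entry A i j : cvgn (fun n => expmx_series A n i j).
Proof.
have [M M_ge0 MA] := mxpow_entry_bound A.
have -> : (fun n => expmx_series A n i j) =
    series (fun k => (k`!%:R)^-1 * (A ^+ k) i j).
  by apply/funext => n; rewrite expmx_series_entry /series /= big_mkord.
apply: normed_cvg; apply: series_le_cvg (is_cvg_series_exp_coeff M) => //=.
- by move=> n; rewrite divr_ge0 ?exprn_ge0.
- move=> n; rewrite normrM ger0_norm ?invr_ge0// mulrC ler_wpM2r ?invr_ge0//.
Qed.

(** The [limn] in [expmx] is meaningful only once the matrix series converges; convergence of its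
    finitely many entries suffices. *)
Lemma cvg_expmx_series A : expmx_series A @ \oo --> expmx A.
Proof.
suff h : cvgn (expmx_series A) by exact: h.
apply/cvg_ex; exists (\matrix_(i, j) limn (fun n => expmx_series A n i j)).
apply/cvg_ballP => e e0.
have H : \forall n \near \oo, forall ij : 'I_N * 'I_N,
    ball (limn (fun n => expmx_series A n ij.1 ij.2)) e (expmx_series A n ij.1 ij.2).
  apply: filter_forall => -[i j] /=.
  by move/cvg_ballP: (@is_cvg_expmx_series_entry A i j); apply.
by apply: filterS H => n H; split => // i j; rewrite mxE; exact: (H (i, j)).
Qed.

Lemma cvg_expmx_series_entry A i j :
  expmx_series A n i j @[n --> \oo] --> expmx A i j.
Proof.
apply: (@cvg_comp _ _ _ (expmx_series A) (fun M : 'M[R]_N => M i j)).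
  exact: cvg_expmx_series.
exact: coord_continuous.
Qed.

(* C(n, k) / n^k tends to 1 / k! at rate 1 / n. *)
Lemma binomial_ratio_bound (n k : nat) : (k <= n.+1)%N ->
  `|'C(n.+1, k)%:R / n.+1%:R ^+ k - (k`!%:R)^-1| <=
    4 ^+ k / k`!%:R / n.+1%:R :> R.
Proof.
set m := n.+1 => kn; have m0 : 0 < m%:R :> R by rewrite ltr0n.
(* Each further factor is 1 - k / m, hence the loss of at most k^2 / m; at the end k^2 <= 4^k
   because k < 2^k. *)
have F_bounds : 1 - k%:R ^+ 2 / m%:R <= ((m ^_ k)%:R / m%:R ^+ k : R) <= 1.
  elim: k kn => [|k IH] kn; first by rewrite ffactn0 expr0n /= mul0r subr0 divr1 lexx.
  have /andP[lo hi] := IH (ltnW kn).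
  have -> : (m ^_ k.+1)%:R / m%:R ^+ k.+1 =
      (m ^_ k)%:R / m%:R ^+ k * (1 - k%:R / m%:R) :> R.
    rewrite ffactnSr natrM natrB ?(leq_trans (ltnW kn))// exprS.
    by field; rewrite expf_neq0 gt_eqF.
  set F := (m ^_ k)%:R / _ in lo hi *.
  have F0 : 0 <= F by rewrite divr_ge0 ?exprn_ge0.
  have -> : k.+1%:R ^+ 2 / m%:R = k%:R ^+ 2 / m%:R + 2 * (k%:R / m%:R) + m%:R^-1 :> R.
    by rewrite -natr1; field; rewrite gt_eqF.
  have r0 : 0 <= k%:R / m%:R :> R by rewrite divr_ge0.
  have i0 : 0 <= m%:R^-1 :> R by rewrite invr_ge0.
  clearbody F; move: (k%:R / m%:R) r0 => r r0.
  have := mulr_ge0 F0 r0; have := ler_wpM2r r0 hi.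
  by rewrite mul1r mulrBr mulr1 => ? ?; apply/andP; split; lra.
have k0 : 0 < k`!%:R :> R by rewrite ltr0n fact_gt0.
have -> : 'C(m, k)%:R = (m ^_ k)%:R / k`!%:R :> R.
  by rewrite -bin_ffact natrM mulfK ?gt_eqF.
have -> : (m ^_ k)%:R / k`!%:R / m%:R ^+ k - (k`!%:R)^-1 =
    ((m ^_ k)%:R / m%:R ^+ k - 1) / k`!%:R :> R.
  by field; rewrite !gt_eqF ?exprn_gt0.
rewrite normrM (ger0_norm (_ : 0 <= (k`!%:R)^-1)) ?invr_ge0//.
rewrite (mulrAC (4 ^+ k)) ler_pM2r ?invr_gt0//.
have /andP[lo hi] := F_bounds.
rewrite ler0_norm ?subr_le0// opprB.
apply: (@le_trans _ _ (k%:R ^+ 2 / m%:R)); first by lra.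
rewrite ler_pM2r ?invr_gt0// -natrX -natrX ler_nat.
by rewrite -[4%N]/(2 ^ 2)%N -expnM mulnC expnM leq_exp2r// ltnW// ltn_expl.
Qed.

(** The binomial expansion is compared term by term with a partial sum of the series; with M
    bounding the powers of [A], the errors add up to at most e^(4M) / (n + 1). *)
Lemma cvg_euler_expmx A i j :
  ((1%:M + n.+1%:R^-1 *: A) ^+ n.+1) i j @[n --> \oo] --> expmx A i j.
Proof.
have [M M_ge0 MA] := mxpow_entry_bound A.
pose e n := ((1%:M + n.+1%:R^-1 *: A) ^+ n.+1) i j.
(* The power [n.+1] has [n.+2] binomial terms, so the partial sum is cut at the same place. *)
pose s n := expmx_series A n.+2 i j.
have s_cvg : s n @[n --> \oo] --> expmx A i j.
  have := @cvg_expmx_series_entry A i j.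
  by rewrite -cvg_shiftS -cvg_shiftS.
have eE n : e n = \sum_(k < n.+2) 'C(n.+1, k)%:R / n.+1%:R ^+ k * (A ^+ k) i j.
  rewrite /e -[1%:M]/(GRing.one _) addrC exprD1n summxE; apply: eq_bigr => k _.
  have -> : (n.+1%:R^-1 *: A) ^+ k = n.+1%:R ^- k *: A ^+ k.
    elim: (k : nat) => [|l IH]; first by rewrite !expr0 invr1 scale1r.
    rewrite !exprS IH invfM -[LHS]/(_ *m _) -scalemxAl -scalemxAr scalerA.
    by rewrite mulrC.
  by rewrite mulmxnE mxE mulrC -mulr_natr; ring.
have diff n : `|e n - s n| <= expR (4 * M) * harmonic n.
  rewrite eE /s expmx_series_entry -sumrB.
  apply: le_trans (ler_norm_sum _ _ _) _.
  apply: (@le_trans _ _ (\sum_(k < n.+2) exp_coeff (4 * M) k / n.+1%:R)).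
    apply: ler_sum => k _.
    have k_le : (k <= n.+1)%N by rewrite -ltnS.
    rewrite -mulrBl normrM /exp_coeff /= exprMn.
    rewrite -[leRHS](_ : 4 ^+ k / k`!%:R / n.+1%:R * M ^+ k = _); last by ring.
    by apply: ler_pM => //; exact: binomial_ratio_bound.
  rewrite -mulr_suml ler_wpM2r ?invr_ge0//.
  have : series (exp_coeff (4 * M)) n.+2 <= expR (4 * M).
    apply: nondecreasing_cvgn_le; last exact: is_cvg_series_exp_coeff.
    apply: nondecreasing_series => l _ _; apply: exp_coeff_ge0; exact: mulr_ge0.
  by rewrite /series /= big_mkord.
have d_cvg : e n - s n @[n --> \oo] --> 0.
  apply: norm_cvg0.
  apply: (@squeeze_cvgr _ _ _ _ (fun=> 0) (fun n => expR (4 * M) * harmonic n)).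
  - by near=> n; rewrite normr_ge0 diff.
  - exact: cvg_cst.
  - rewrite -[X in _ --> X](mulr0 (expR (4 * M))); apply: cvgM; first exact: cvg_cst.
    exact: cvg_harmonic.
have -> : (fun n => ((1%:M + n.+1%:R^-1 *: A) ^+ n.+1) i j) = (fun n => s n + (e n - s n)).
  by apply/funext => n; rewrite (addrC (s n)) subrK.
rewrite -[X in _ --> X]addr0; exact: cvgD.
Unshelve. all: by end_near. Qed.

End MatrixExponential.

(** * The semigroup of a jump process *)

Section Semigroup.
Variables (R : realType) (N : nat) (W : 'M[R]_N) (p : 'cV[R]_N) (t : R).

Lemma cvg_linear_expmx (A c : 'M[R]_N) :
  \sum_i \sum_j ((1%:M + n.+1%:R^-1 *: A) ^+ n.+1) i j * c i j @[n --> \oo] -->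
  \sum_i \sum_j expmx A i j * c i j.
Proof.
apply: cvg_big => [|i _]; first exact: add_continuous.
apply: cvg_big => [|j _]; first exact: add_continuous.
by apply: cvgMl; exact: cvg_euler_expmx.
Qed.

Lemma expmx0 : expmx (0 : 'M[R]_N) = 1%:M.
Proof.
apply/matrixP => i j; have := @cvg_euler_expmx R N 0 i j.
have -> : (fun n => ((1%:M + n.+1%:R^-1 *: (0 : 'M[R]_N)) ^+ n.+1) i j) = (fun=> 1%:M i j).
  by apply/funext => n; rewrite scaler0 addr0 -[1%:M]/(GRing.one _) expr1n.
by move/(cvg_lim (@Rhausdorff R)) => <-; rewrite lim_cst.
Qed.

Hypotheses (W_rate : jump_rate_matrix W) (W_ldb : local_detailed_balance W)
  (p_steady : steady_state W p) (t_gt0 : 0 < t).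

(** For large [n] the diagonal of one Euler factor is nonnegative; each of the n + 1 factors then
    costs t sigma / (n + 1). *)
Lemma near_euler_kernel : \forall n \near \oo,
  stationary_kernel ((1%:M + n.+1%:R^-1 *: (t *: W)) ^+ n.+1) p /\
  reversal_entropy ((1%:M + n.+1%:R^-1 *: (t *: W)) ^+ n.+1) p <=
    t * entropy_production W p.
Proof.
have [p_ge0 _ _] := p_steady.
have diag : \forall n \near \oo, forall i, 0 <= 1 + (t / n.+1%:R) * W i i.
  apply: filter_forall => i; apply: filterS (nbhs_infty_ger (- (t * W i i))) => n /= h.
  have n0 : 0 < n.+1%:R :> R by rewrite ltr0n.
  rewrite -(pmulr_rge0 _ n0) (_ : n.+1%:R * _ = n.+1%:R + t * W i i).
    have hn : n%:R <= n.+1%:R :> R by rewrite ler_nat.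
    lra.
  by field; rewrite gt_eqF.
apply: filterS diag => n diag.
have n0 : 0 < n.+1%:R :> R by rewrite ltr0n.
have h0 : 0 < t / n.+1%:R by rewrite divr_gt0.
have [Qk QE] := euler_kernel W_rate W_ldb p_steady h0 diag.
rewrite scalerA mulrC.
have [Qk' QE'] := stationary_kernelX n.+1 p_ge0 Qk.
split => //; apply: le_trans QE' _; rewrite QE mulrA.
by rewrite (_ : _ * (t / _) = t) //; field; rewrite gt_eqF.
Qed.

Let P := expmx (t *: W).

(** Only inequalities linear in the kernel are passed to the limit, so the relative entropy of the
    limit is never formed. *)
Lemma expmx_linear_le (c : 'M[R]_N) (u : R) :
  (forall Q, stationary_kernel Q p -> reversal_entropy Q p <= t * entropy_production W p ->
    \sum_i \sum_j Q i j * c i j <= u) ->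
  \sum_i \sum_j P i j * c i j <= u.
Proof.
move=> Hc; have lim := @cvg_linear_expmx (t *: W) c.
apply: (cvgr_to_le lim).
by apply: filterS near_euler_kernel => n [? ?]; exact: Hc.
Qed.

Lemma expmx_linear_eq (c : 'M[R]_N) (u : R) :
  (forall Q, stationary_kernel Q p -> \sum_i \sum_j Q i j * c i j = u) ->
  \sum_i \sum_j P i j * c i j = u.
Proof.
move=> Hc; apply/eqP; rewrite eq_le expmx_linear_le/= => [|Q /Hc-> //].
have E (Q : 'M[R]_N) :
    \sum_i \sum_j Q i j * (- c) i j = - \sum_i \sum_j Q i j * c i j.
  rewrite -sumrN; apply: eq_bigr => i _; rewrite -sumrN.
  by apply: eq_bigr => j _; rewrite mxE mulrN.
rewrite -lerN2 -E; apply: expmx_linear_le => Q /Hc QE _.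
by rewrite E QE.
Qed.

Let sum_delta (Q : 'M[R]_N) m n :
  \sum_i \sum_j Q i j * ((i == m) && (j == n))%:R = Q m n.
Proof.
rewrite (bigD1 m)//= (bigD1 n)//= !eqxx mulr1 !big1 ?addr0// => i.
  by move=> /negPf im; apply: big1 => j _; rewrite im mulr0.
by move=> /negPf ->; rewrite andbF mulr0.
Qed.

Lemma expmx_ge0 m n : 0 <= P m n.
Proof.
have := @expmx_linear_le (\matrix_(i, j) - ((i == m) && (j == n))%:R) 0.
have E (Q : 'M[R]_N) : \sum_i \sum_j Q i j * (\matrix_(i, j) - ((i == m) && (j == n))%:R) i j =
    - Q m n.
  rewrite -[in RHS](sum_delta Q) -sumrN; apply: eq_bigr => i _; rewrite -sumrN.
  by apply: eq_bigr => j _; rewrite mxE mulrN.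
rewrite E oppr_le0; apply => Q [Q_ge0 _ _ _] _; by rewrite E oppr_le0.
Qed.

Lemma expmx_col_sum n : \sum_m P m n = 1.
Proof.
have E (Q : 'M[R]_N) : \sum_i \sum_j Q i j * (\matrix_(i, j) (j == n)%:R) i j = \sum_m Q m n.
  apply: eq_bigr => i _; rewrite (bigD1 n)//= mxE eqxx mulr1 big1 ?addr0// => j /negPf jn.
  by rewrite mxE jn mulr0.
by rewrite -E; apply: expmx_linear_eq => Q [_ Qcol _ _]; rewrite E.
Qed.

Lemma expmx_row_sum m : \sum_n P m n * p n 0 = p m 0.
Proof.
have E (Q : 'M[R]_N) : \sum_i \sum_j Q i j * (\matrix_(i, j) ((i == m)%:R * p j 0)) i j =
    \sum_n Q m n * p n 0.
  rewrite (bigD1 m)//= [X in _ + X]big1 ?addr0 => [|i /negPf im].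
    by apply: eq_bigr => j _; rewrite mxE eqxx mul1r.
  by apply: big1 => j _; rewrite mxE im mul0r mulr0.
rewrite -E; apply: expmx_linear_eq => Q [_ _ Qp _].
by rewrite E; have := congr1 (fun v : 'cV_N => v m 0) Qp; rewrite mxE.
Qed.

Lemma expmx_quadratic (y : 'I_N -> 'I_N -> R) : (forall m n, y n m = - y m n) ->
  4 * (\sum_m \sum_n P m n * p n 0 * y m n) -
    2 * (\sum_m \sum_n P m n * p n 0 * y m n ^+ 2) <= t * entropy_production W p.
Proof.
move=> y_anti; have [p_ge0 _ _] := p_steady.
have E (Q : 'M[R]_N) : \sum_i \sum_j Q i j *
      (\matrix_(i, j) (p j 0 * (4 * y i j - 2 * y i j ^+ 2))) i j =
    4 * (\sum_m \sum_n Q m n * p n 0 * y m n) -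
    2 * (\sum_m \sum_n Q m n * p n 0 * y m n ^+ 2).
  rewrite !mulr_sumr -sumrB; apply: eq_bigr => i _; rewrite !mulr_sumr -sumrB.
  by apply: eq_bigr => j _; rewrite mxE; ring.
rewrite -E; apply: expmx_linear_le => Q Qk Qt; rewrite E.
by apply: le_trans Qt; exact: reversal_entropy_quadratic.
Qed.

(* A thermodynamic uncertainty relation: the previous bound, optimized over the
   scaling of y. *)
Lemma expmx_uncertainty (y : 'I_N -> 'I_N -> R) : (forall m n, y n m = - y m n) ->
  2 * (\sum_m \sum_n P m n * p n 0 * y m n) ^+ 2 <=
    t * entropy_production W p * \sum_m \sum_n P m n * p n 0 * y m n ^+ 2.
Proof.
move=> y_anti; have [p_ge0 _ _] := p_steady.
set X := \sum_m _; set Y := \sum_m _; set K := t * _.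
have Y_ge0 : 0 <= Y.
  by apply: sumr_ge0 => m _; apply: sumr_ge0 => n _; rewrite mulr_ge0 ?sqr_ge0// mulr_ge0// expmx_ge0.
have H s : 4 * s * X - 2 * s ^+ 2 * Y <= K.
  have := @expmx_quadratic (fun m n => s * y m n).
  have -> : \sum_m \sum_n P m n * p n 0 * (s * y m n) = s * X.
    rewrite /X mulr_sumr; apply: eq_bigr => m _; rewrite mulr_sumr.
    by apply: eq_bigr => n _; rewrite mulrCA.
  have -> : \sum_m \sum_n P m n * p n 0 * (s * y m n) ^+ 2 = s ^+ 2 * Y.
    rewrite /Y mulr_sumr; apply: eq_bigr => m _; rewrite mulr_sumr.
    by apply: eq_bigr => n _; rewrite exprMn mulrCA.
  by rewrite !mulrA; apply => m n; rewrite y_anti mulrN.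
(* If Y = 0 the bound [H] is linear in [s] and forces X = 0: the chosen [s] would give K + 1 <=
   K. *)
have [Y0|Y0] := eqVneq Y 0.
  have [->|X0] := eqVneq X 0; first by rewrite Y0 expr0n /= !mulr0.
  have := H ((K + 1) / (4 * X)); rewrite Y0 mulr0 subr0.
  have -> : 4 * ((K + 1) / (4 * X)) * X = K + 1 by field.
  by lra.
have Y_gt0 : 0 < Y by rewrite lt0r Y0.
(* The maximizer over [s] of the left side of [H]. *)
have := H (X / Y).
have -> : 4 * (X / Y) * X - 2 * (X / Y) ^+ 2 * Y = 2 * X ^+ 2 / Y by field.
by rewrite ler_pdivrMr.
Qed.

End Semigroup.

(** * Cycles *)

(** The default of [nth] is the head of the cycle, so the index just past the end returns to the
    start and closes the path. *)
Lemma sum_cycle_edges (T : eqType) (V : nmodType) (F : T -> T -> V) (x : T) (s : seq T) :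
  uniq (x :: s) ->
  \sum_(n <- x :: s) F n (next (x :: s) n) =
  \sum_(i < (size s).+1) F (nth x (x :: s) i) (nth x (x :: s) i.+1).
Proof.
move=> c_uniq; rewrite (big_nth x) big_mkord; apply: eq_bigr => i _.
by rewrite next_nth mem_nth// index_uniq.
Qed.

Lemma cycle_isoperimetric (R : realType) (N : nat) (a b : 'cV[R]_N) (c : seq 'I_N) :
  (2 <= N)%N -> is_cycle c ->
  \sum_(n <- c) (a n 0 * b (next c n) 0 - a (next c n) 0 * b n 0) <=
  cycle_length a b c ^+ 2 / (2 * N%:R * tan (pi / N%:R)).
Proof.
move=> N_ge2 /andP[c_uniq]; case: c c_uniq => [//|x s] c_uniq _.
rewrite /cycle_length.
rewrite (sum_cycle_edges (fun n m => a n 0 * b m 0 - a m 0 * b n 0) c_uniq).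
rewrite (sum_cycle_edges (fun n m => Num.sqrt ((a n 0 - a m 0) ^+ 2 + (b n 0 - b m 0) ^+ 2)) c_uniq).
pose X i := a (nth x (x :: s) i) 0; pose Y i := b (nth x (x :: s) i) 0.
apply: (@polygon_isoperimetric R X Y N (size s).+1) => //.
(* The states of a cycle are distinct, so it has at most N edges. *)
- by have := max_card (mem (x :: s)); rewrite card_ord (card_uniqP c_uniq).
- by rewrite /X /= nth_default.
- by rewrite /Y /= nth_default.
Qed.

(** Exchanging [a] and [b] reflects the plane: the signed area changes sign and the lengths stay. *)
Lemma cycle_isoperimetric_norm (R : realType) (N : nat) (a b : 'cV[R]_N) (c : seq 'I_N) :
  (2 <= N)%N -> is_cycle c ->
  `|\sum_(n <- c) (a n 0 * b (next c n) 0 - a (next c n) 0 * b n 0)| <=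
  cycle_length a b c ^+ 2 / (2 * N%:R * tan (pi / N%:R)).
Proof.
move=> N_ge2 c_cycle; rewrite ler_norml cycle_isoperimetric// andbT lerNl.
have := cycle_isoperimetric b a N_ge2 c_cycle.
have -> : cycle_length b a c = cycle_length a b c.
  by apply: eq_bigr => n _; rewrite addrC.
apply: le_trans; rewrite -sumrN le_eqVlt; apply/orP; left; apply/eqP.
by apply: eq_bigr => n _; ring.
Qed.

(** An antisymmetric [y] sees only the antisymmetric part of [A], which is the current. Each pair of
    states is then counted once, along the direction of positive current, where the decomposition
    applies. *)
Lemma cycle_decomposition_sum (R : realType) (N : nat) (A : 'I_N -> 'I_N -> R)
    (J : 'M[R]_N) (K : {fset seq 'I_N}) (w : seq 'I_N -> R) (y : 'I_N -> 'I_N -> R) :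
  uniform_cycle_decomposition J K w -> (forall m n, J m n = A m n - A n m) ->
  (forall m n, y n m = - y m n) ->
  \sum_m \sum_n A m n * y m n =
  \sum_(c <- K) w c * \sum_(n <- c) y (next c n) n.
Proof.
move=> [K_cycle _ K_pos K_dec] JE y_anti.
transitivity (\sum_m \sum_(n | 0 < J m n) J m n * y m n).
  have E m : \sum_n A m n * y m n = \sum_(n | 0 < J m n) A m n * y m n +
      \sum_(n | J m n < 0) A m n * y m n + \sum_(n | J m n == 0) A m n * y m n.
    rewrite (bigID (fun n => 0 < J m n)) /= -addrA; congr (_ + _).
    rewrite (bigID (fun n => J m n < 0)) /=; congr (_ + _); apply: eq_bigl => n.
      by case: ltrgtP.
    by case: ltrgtP.
  under eq_bigr do rewrite E.
  rewrite !big_split /=.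
  (* Where the current vanishes [A] is symmetric, so this sum equals its own opposite. *)
  have -> : \sum_m \sum_(n | J m n == 0) A m n * y m n = 0.
    have : \sum_m \sum_(n | J m n == 0) A m n * y m n =
        - \sum_m \sum_(n | J m n == 0) A m n * y m n.
      rewrite {1}(exchange_big_dep predT)//= -sumrN; apply: eq_bigr => n _.
      rewrite -sumrN; apply: eq_big => m; first by rewrite !JE !subr_eq0 eq_sym.
      by rewrite JE subr_eq0 => /eqP ->; rewrite (y_anti n m) mulrN.
    lra.
  rewrite addr0 [X in _ + X](exchange_big_dep predT)//= -big_split /=.
  apply: eq_bigr => m _.
  rewrite [X in _ + X](eq_bigl (fun n => 0 < J m n)) => [|n]; last first.
    by rewrite !JE subr_lt0 subr_gt0.
  by rewrite -big_split /=; apply: eq_bigr => n _; rewrite JE (y_anti m n); ring.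
transitivity (\sum_m \sum_(n | 0 < J m n) \sum_(c <- K | edge_in n m c) w c * y m n).
  by apply: eq_bigr => m _; apply: eq_bigr => n Jmn; rewrite K_dec// mulr_suml.
transitivity (\sum_m \sum_n \sum_(c <- K | (0 < J m n) && edge_in n m c) w c * y m n).
  apply: eq_bigr => m _; rewrite big_mkcond; apply: eq_bigr => n _.
  by case: ifP => _ //; rewrite big_pred0.
under eq_bigr do rewrite (exchange_big_dep predT)//=.
rewrite (exchange_big_dep predT)//= big_seq [RHS]big_seq; apply: eq_bigr => c cK.
rewrite mulr_sumr; have /andP[c_uniq _] := K_cycle c cK.
rewrite [RHS]big_uniq//= (exchange_big_dep predT)//= [RHS]big_mkcond /=.
(* Edges of [c] carry positive current, so that condition is absorbed; the only edge of [c] leaving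
   [n] ends at [next c n]. *)
apply: eq_bigr => n _; rewrite [LHS](eq_bigl (edge_in n ^~ c)) => [|m]; last first.
  by apply: andb_idl => e; exact: K_pos e.
case: ifP => nc; last by rewrite big_pred0// => m; rewrite /edge_in nc.
rewrite (big_pred1 (next c n)) // => m; by rewrite /edge_in nc eq_sym.
Qed.

(** * Correlations *)

Section Correlations.
Variables (R : realType) (N : nat) (W : 'M[R]_N) (p : 'cV[R]_N) (t : R).
Implicit Types a b : 'cV[R]_N.

Let A m n := expmx (t *: W) m n * p n 0.

Lemma corrE a b s :
  corr W p b a s = \sum_m \sum_n expmx (s *: W) m n * p n 0 * (b m 0 * a n 0).
Proof.
rewrite /corr mul_mx_diag mxE exchange_big /=; apply: eq_bigr => n _.
rewrite !mxE mulr_suml mulr_suml; apply: eq_bigr => m _; rewrite !mxE; ring.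
Qed.

Lemma dcorrE a b :
  dcorr W p b a t = \sum_m \sum_n A m n * (a n 0 * b m 0 - a m 0 * b n 0).
Proof.
rewrite /dcorr !corrE -sumrB; apply: eq_bigr => m _; rewrite -sumrB.
by apply: eq_bigr => n _; rewrite /A; ring.
Qed.

Hypotheses (W_rate : jump_rate_matrix W) (W_ldb : local_detailed_balance W)
  (p_steady : steady_state W p) (t_gt0 : 0 < t).

(** Both marginals of the two-time law are [p], so each pure square in the expansion yields the
    correlation at time 0. *)
Lemma dissimE a :
  2 * dissim W p a t = \sum_m \sum_n A m n * (a m 0 - a n 0) ^+ 2.
Proof.
have -> : \sum_m \sum_n A m n * (a m 0 - a n 0) ^+ 2 =
    \sum_m \sum_n A m n * a m 0 ^+ 2 + \sum_m \sum_n A m n * a n 0 ^+ 2 -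
    2 * corr W p a a t.
  rewrite corrE -big_split mulr_sumr -sumrB; apply: eq_bigr => m _ /=.
  rewrite -big_split mulr_sumr -sumrB; apply: eq_bigr => n _ /=.
  by rewrite /A; ring.
have -> : \sum_m \sum_n A m n * a m 0 ^+ 2 = corr W p a a 0.
  rewrite corrE scale0r expmx0; apply: eq_bigr => m _.
  rewrite -mulr_suml (expmx_row_sum W_rate W_ldb p_steady t_gt0) (bigD1 m)//= mxE eqxx /=.
  rewrite big1 ?addr0; first by ring.
  by move=> n /negPf nm; rewrite mxE eq_sym nm !mul0r.
have -> : \sum_m \sum_n A m n * a n 0 ^+ 2 = corr W p a a 0.
  rewrite corrE scale0r expmx0 exchange_big [RHS]exchange_big; apply: eq_bigr => n _ /=.
  rewrite -mulr_suml -mulr_suml (expmx_col_sum W_rate W_ldb p_steady t_gt0) (bigD1 n)//= mxE eqxx /=.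
  rewrite big1 ?addr0; first by ring.
  by move=> m /negPf nm; rewrite mxE nm !mul0r.
rewrite /dissim; ring.
Qed.

Let joint_ge0 m n : 0 <= A m n.
Proof.
by have [p_ge0 _ _] := p_steady; rewrite mulr_ge0// (expmx_ge0 W_rate W_ldb p_steady).
Qed.

Let D a b := dissim W p a t + dissim W p b t.

Let dissimDE a b : 2 * D a b =
  \sum_m \sum_n A m n * ((a m 0 - a n 0) ^+ 2 + (b m 0 - b n 0) ^+ 2).
Proof.
rewrite /D mulrDr !dissimE -big_split; apply: eq_bigr => m _ /=.
by rewrite -big_split; apply: eq_bigr => n _ /=; rewrite mulrDr.
Qed.

Lemma dissim_add_ge0 a b : 0 <= D a b.
Proof.
rewrite -(pmulr_rge0 _ (_ : 0 < 2))// dissimDE.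
apply: sumr_ge0 => m _; apply: sumr_ge0 => n _.
by rewrite mulr_ge0// addr_ge0 ?sqr_ge0.
Qed.

Let uncertainty := expmx_uncertainty W_rate W_ldb p_steady t_gt0.

Lemma t_entropy_production_ge0 : 0 <= t * entropy_production W p.
Proof.
have := @expmx_quadratic _ _ _ _ _ W_rate W_ldb p_steady t_gt0 (fun _ _ => 0).
rewrite !big1; first last.
- by move=> m _; rewrite big1// => n _; rewrite mulr0.
- by move=> m _; rewrite big1// => n _; rewrite expr0n mulr0.
by rewrite !mulr0 subrr; apply => m n; rewrite oppr0.
Qed.

(** The cross product of two points equals that of the first point with their difference, so its
    square is at most the squared norm times the squared distance. *)
Lemma dcorr_le_sqnorm a b :
  dcorr W p b a t ^+ 2 <= t * entropy_production W p * sqnorm_sup a b * D a b.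
Proof.
pose x m n := a n 0 * b m 0 - a m 0 * b n 0.
have := @uncertainty x (fun m n => _); rewrite -dcorrE => /(_ _) h.
rewrite -(ler_pM2l (_ : 0 < 2))//; apply: le_trans (h _) _.
  by move=> m n; rewrite /x; ring.
have -> : 2 * (t * entropy_production W p * sqnorm_sup a b * D a b) =
    t * entropy_production W p * (sqnorm_sup a b * (2 * D a b)) by ring.
rewrite ler_wpM2l ?t_entropy_production_ge0// dissimDE mulr_sumr.
apply: ler_sum => m _; rewrite mulr_sumr; apply: ler_sum => n _.
rewrite [leRHS]mulrCA ler_wpM2l ?joint_ge0//.
apply: (@le_trans _ _ ((a n 0 ^+ 2 + b n 0 ^+ 2) *
    ((a m 0 - a n 0) ^+ 2 + (b m 0 - b n 0) ^+ 2))).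
  rewrite -subr_ge0 (_ : _ - _ =
    (a n 0 * (a m 0 - a n 0) + b n 0 * (b m 0 - b n 0)) ^+ 2) ?sqr_ge0//.
  by rewrite /x; ring.
rewrite ler_wpM2r ?addr_ge0 ?sqr_ge0//.
exact: (le_bigmax 0 (fun n : 'I_N => a n 0 ^+ 2 + b n 0 ^+ 2)).
Qed.

(** In the isoperimetric bound for each cycle one of the two factors [cycle_length a b c] is
    replaced by the maximum. The other one survives and is recovered as a sum of [y], to which the
    uncertainty relation applies. *)
Lemma dcorr_le_cycle_length a b (K : {fset seq 'I_N}) (w : seq 'I_N -> R) :
  (3 <= N)%N -> uniform_cycle_decomposition (current W p t) K w ->
  dcorr W p b a t ^+ 2 <= t * entropy_production W p *
    (max_cycle_length a b K / (2 * N%:R * tan (pi / N%:R))) ^+ 2 * D a b.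
Proof.
move=> N_ge3 K_dec; set G := _ / _; have [K_cycle w_gt0 K_pos _] := K_dec.
have JE m n : current W p t m n = A m n - A n m by rewrite mxE.
pose l m n := Num.sqrt ((a n 0 - a m 0) ^+ 2 + (b n 0 - b m 0) ^+ 2).
(* The sign of the current makes the distance antisymmetric and leaves it positive or zero along
   every edge of a cycle in [K]. *)
pose y m n := Num.sg (current W p t m n) * l m n.
have y_anti m n : y n m = - y m n.
  rewrite /y !JE -opprB sgrN mulNr; congr (- (_ * Num.sqrt _)); ring.
have N2 : (2 <= N)%N by rewrite ltnW.
have den_ge0 : 0 <= 2 * N%:R * tan (pi / N%:R) :> R.
  have N3 : 3 <= N%:R :> R by rewrite ler_nat.
  have pi0 := pi_gt0 R.
  have x0 : 0 < pi / N%:R :> R by rewrite divr_gt0//; lra.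
  have x_lt : pi / N%:R <= pi / 2 :> R by rewrite ler_pM2l// lef_pV2 ?posrE; lra.
  rewrite mulr_ge0// /tan divr_ge0//.
    by rewrite sin_ge0_pi// ltW//=; lra.
  by rewrite cos_ge0_pihalf// x_lt andbT; lra.
have X_le : `|dcorr W p b a t| <= G * \sum_m \sum_n A m n * y m n.
  rewrite dcorrE (cycle_decomposition_sum K_dec JE (y := fun m n => _)); last first.
    by move=> m n; ring.
  rewrite (cycle_decomposition_sum K_dec JE y_anti).
  apply: le_trans (ler_norm_sum _ _ _) _; rewrite mulr_sumr.
  rewrite big_seq [leRHS]big_seq; apply: ler_sum => c cK.
  rewrite normrM (ger0_norm (ltW (w_gt0 _ cK))) mulrCA ler_pM2l ?w_gt0//.
  apply: le_trans (cycle_isoperimetric_norm a b N2 (K_cycle _ cK)) _.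
  have -> : \sum_(n <- c) y (next c n) n = cycle_length a b c.
    rewrite /cycle_length big_seq [RHS]big_seq; apply: eq_bigr => n nc.
    by rewrite /y gtr0_sg ?mul1r// (K_pos c)// /edge_in nc eqxx.
  have l_ge0 : 0 <= cycle_length a b c by apply: sumr_ge0 => n _; exact: sqrtr_ge0.
  rewrite expr2 /G [leRHS]mulrAC ler_wpM2r ?invr_ge0// ler_wpM2r//.
  by apply: le_bigmax_seq.
have -> : dcorr W p b a t ^+ 2 = `|dcorr W p b a t| ^+ 2 by rewrite real_normK ?num_real.
set Y := \sum_m _ in X_le.
have Y_le : 2 * Y ^+ 2 <= t * entropy_production W p * (2 * D a b).
  apply: le_trans (uncertainty y_anti) _.
  rewrite ler_wpM2l ?t_entropy_production_ge0// dissimDE.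
  apply: ler_sum => m _; apply: ler_sum => n _; rewrite ler_wpM2l ?joint_ge0//.
  rewrite /y exprMn /l sqr_sqrtr ?addr_ge0 ?sqr_ge0//.
  rewrite -(sqrrN (a m 0 - _)) -(sqrrN (b m 0 - _)) !opprB.
  by rewrite ler_piMl ?addr_ge0 ?sqr_ge0// sqr_sg lern1 leq_b1.
apply: (@le_trans _ _ (G ^+ 2 * Y ^+ 2)).
  by rewrite -exprMn ler_sqr ?nnegrE// (le_trans _ X_le).
rewrite [leRHS]mulrAC [leRHS]mulrC ler_wpM2l ?sqr_ge0//; lra.
Qed.

End Correlations.

Theorem mainTheorem3 (R : realType) (N : nat) (W : 'M[R]_N)
    (p : 'cV[R]_N) (t : R) (a b : 'cV[R]_N)
    (K : {fset seq 'I_N}) (w : seq 'I_N -> R)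
    (N_ge3 : (3 <= N)%N)
    (W_rate : jump_rate_matrix W)
    (W_ldb : local_detailed_balance W)
    (W_spec : spectral_assumption W)
    (p_steady : steady_state W p)
    (t_gt0 : 0 < t)
    (D_neq0 : dissim W p a t + dissim W p b t != 0)
    (K_dec : uniform_cycle_decomposition (current W p t) K w) :
  `|dcorr W p b a t| ^+ 2 / (dissim W p a t + dissim W p b t) <=
    t * entropy_production W p *
    Num.min (sqnorm_sup a b)
      ((max_cycle_length a b K / (2 * N%:R * tan (pi / N%:R))) ^+ 2).
Proof.
have D_gt0 : 0 < dissim W p a t + dissim W p b t.
  by rewrite lt0r D_neq0 (dissim_add_ge0 W_rate W_ldb p_steady t_gt0).
rewrite ler_pdivrMr// real_normK ?num_real//.
case: (leP (sqnorm_sup a b) _) => _; first exact: (dcorr_le_sqnorm W_rate W_ldb p_steady t_gt0).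
exact: (dcorr_le_cycle_length W_rate W_ldb p_steady t_gt0 a b N_ge3 K_dec).
Qed.
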